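(* Let $\mathbb{F}$ be a field of characteristic zero, let $n\geq 2$, and let $\mathfrak{sl}_n$ be the Lie algebra of traceless $n\times n$ matrices over $\mathbb{F}$. Then every anti-automorphism of $\mathfrak{sl}_n$ is a local automorphism of $\mathfrak{sl}_n$.
   Context: The Lie bracket on $\mathfrak{sl}_n$ is the commutator $[a,b]=ab-ba$. For a Lie algebra $\mathfrak{g}$ over $\mathbb{F}$, a linear bijective map $\varphi:\mathfrak{g}\to\mathfrak{g}$ is an automorphism (resp. an anti-automorphism) if $\varphi([x,y])=[\varphi(x),\varphi(y)]$ (resp. $\varphi([x,y])=[\varphi(y),\varphi(x)]$) for all $x,y\in\mathfrak{g}$. A linear map $\Delta:\mathfrak{g}\to\mathfrak{g}$ is a local automorphism if for every $X\in\mathfrak{g}$ there exists an automorphism $\varphi_X$ of $\mathfrak{g}$ (depending on $X$) with $\Delta(X)=\varphi_X(X)$. *)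

(* Defs.v *)
From HB Require Import structures.
From mathcomp Require Import all_boot all_order all_algebra.
From mathcomp Require Import ring.

Set Implicit Arguments.
Unset Strict Implicit.
Unset Printing Implicit Defensive.

Import GRing.Theory.
Local Open Scope ring_scope.

HB.mixin Record Lmodule_isLieAlgebra (F : fieldType) L of GRing.Lmodule F L := {
  lie : L -> L -> L;
  lie_linearl : forall (a : F) (x y z : L),
    lie (a *: x + y) z = a *: lie x z + lie y z;
  lie_linearr : forall (a : F) (x y z : L),
    lie x (a *: y + z) = a *: lie x y + lie x z;
  liexx : forall x : L, lie x x = 0;
  lie_jacobi : forall x y z : L,
    lie x (lie y z) + lie y (lie z x) + lie z (lie x y) = 0
}.

#[short(type="lieAlgType")]
HB.structure Definition LieAlgebra (F : fieldType) :=
  {L of Lmodule_isLieAlgebra F L & GRing.Lmodule F L}.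

Definition lie_automorphism (F : fieldType) (L : lieAlgType F)
    (phi : {linear L -> L}) : Prop :=
  bijective phi /\ forall x y : L, phi (lie x y) = lie (phi x) (phi y).

Definition lie_anti_automorphism (F : fieldType) (L : lieAlgType F)
    (phi : {linear L -> L}) : Prop :=
  bijective phi /\ forall x y : L, phi (lie x y) = lie (phi y) (phi x).

Definition local_automorphism (F : fieldType) (L : lieAlgType F)
    (Delta : {linear L -> L}) : Prop :=
  forall x : L, exists phi : {linear L -> L},
    lie_automorphism phi /\ Delta x = phi x.

Definition traceless (F : fieldType) (n : nat) : {pred 'M[F]_n} :=
  fun A => \tr A == 0.

Lemma traceless_submod_closed (F : fieldType) (n : nat) :
  submod_closed (@traceless F n).
Proof.
split=> [|a A B]; rewrite !unfold_in ?mxtrace0 //.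
by move=> /eqP trA /eqP trB; rewrite mxtraceD mxtraceZ trA trB mulr0 addr0.
Qed.

HB.instance Definition _ (F : fieldType) (n : nat) :=
  GRing.isSubmodClosed.Build F 'M[F]_n (@traceless F n)
    (@traceless_submod_closed F n).

Record sl (F : fieldType) (n : nat) := Sl {
  sl_val :> 'M[F]_n;
  sl_valP : sl_val \in @traceless F n
}.

HB.instance Definition _ (F : fieldType) (n : nat) :=
  [isSub for @sl_val F n].
HB.instance Definition _ (F : fieldType) (n : nat) :=
  [Choice of sl F n by <:].
HB.instance Definition _ (F : fieldType) (n : nat) :=
  [SubChoice_isSubLmodule of sl F n by <:].

Lemma traceless_commutator (F : fieldType) (n : nat) (A B : 'M[F]_n) :
  A *m B - B *m A \in @traceless F n.
Proof. by rewrite unfold_in raddfB /= mxtrace_mulC subrr. Qed.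

Definition sl_lie (F : fieldType) (n : nat) (a b : sl F n) : sl F n :=
  Sl (traceless_commutator a b).

Lemma sl_lie_linearl (F : fieldType) (n : nat) (c : F) (x y z : sl F n) :
  sl_lie (c *: x + y) z = c *: sl_lie x z + sl_lie y z.
Proof.
apply: val_inj => /=; rewrite mulmxDl mulmxDr -scalemxAl -scalemxAr.
by rewrite scalerBr opprD addrACA.
Qed.

Lemma sl_lie_linearr (F : fieldType) (n : nat) (c : F) (x y z : sl F n) :
  sl_lie x (c *: y + z) = c *: sl_lie x y + sl_lie x z.
Proof.
apply: val_inj => /=; rewrite mulmxDl mulmxDr -scalemxAl -scalemxAr.
by rewrite scalerBr opprD addrACA.
Qed.

Lemma sl_liexx (F : fieldType) (n : nat) (x : sl F n) : sl_lie x x = 0.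
Proof. by apply: val_inj; rewrite /= subrr. Qed.

Lemma sl_lie_jacobi (F : fieldType) (n : nat) (x y z : sl F n) :
  sl_lie x (sl_lie y z) + sl_lie y (sl_lie z x) + sl_lie z (sl_lie x y) = 0.
Proof.
apply: val_inj => /=; rewrite !(mulmxBl, mulmxBr) !mulmxA.
set a := x *m y *m z; set b := x *m z *m y; set c := y *m z *m x.
set d := y *m x *m z; set e := z *m x *m y; set f := z *m y *m x.
suff E (p q r s t u : 'M[F]_n) :
  (p - q - (r - s)) + (r - t - (u - q)) + (u - s - (p - t)) = 0 by exact: E.
rewrite !opprB !addrA.
by apply/matrixP=> i j; rewrite !mxE; ring.
Qed.

HB.instance Definition _ (F : fieldType) (n : nat) :=
  Lmodule_isLieAlgebra.Build F (sl F n) (@sl_lie_linearl F n)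
    (@sl_lie_linearr F n) (@sl_liexx F n) (@sl_lie_jacobi F n).

(* Main.v *)
Require Import Defs.
From HB Require Import structures.
From mathcomp Require Import all_boot all_order all_algebra.
From mathcomp Require Import perm zify.

Import GRing.Theory.
Local Open Scope ring_scope.

(** The transpose is itself an anti-automorphism of sl_n, and so is every map
    Y |-> (P Y P^-1)^T with P invertible.  Since any square matrix X is similar
    to its transpose, P can be chosen with P X P^-1 = X^T, and the corresponding
    anti-automorphism psi then fixes X ([fixed_by_anti_automorphism]).  For an
    arbitrary anti-automorphism phi, the composite phi o psi is an automorphism
    and agrees with phi at X.

    The substance is therefore the similarity of A and A^T ([similar_trmx]),
    over an arbitrary field.  It is obtained by splitting F^n into A-stable
    summands on each of which the similarity is given by a Hankel matrix, that
    is, by a symmetric form for which A is self-adjoint.  For a row f and a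
    column v, let K have rows f A^i and C have columns A^j v, for i, j < d.
    Then H = K C has entries f A^(i+j) v.  Suppose that H is invertible and d is
    as large as possible.  If f A^d were not in the row space of K, a column w
    killed by K with f A^d w = 1 would give a Hankel matrix of size d+1 that is
    antitriangular with unit antidiagonal; hence the row space of K is A-stable
    and, dually, so is the column space of C ([krylov_bistable]).  So C H^-1 K is a projection commuting with A, and
    K^T H^-1 K intertwines A and A^T on its image ([cyclic_summand]).  Induction
    on the rank of the complementary projection finishes the proof
    ([idempotent_transpose_intertwined]).

    Summands are represented throughout by idempotent matrices commuting with
    A, which keeps all computations in n x n matrices, without any choice of
    bases. *)

Set Implicit Arguments.
Unset Strict Implicit.
Unset Printing Implicit Defensive.

(** * Krylov and Hankel matrices *)

Definition krylov (F : fieldType) (n : nat) (A : 'M[F]_n) (f : 'rV[F]_n)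
    (d : nat) : 'M[F]_(d, n) :=
  \matrix_(i < d) (f *m A ^+ i).

Definition hankel (F : fieldType) (n : nat) (A : 'M[F]_n) (f : 'rV[F]_n)
    (v : 'cV[F]_n) (d : nat) : 'M[F]_d :=
  \matrix_(i < d, j < d) (f *m A ^+ (i + j) *m v) 0 0.

Lemma trmxX (F : fieldType) (n : nat) (A : 'M[F]_n) (k : nat) :
  (A ^+ k)^T = A^T ^+ k.
Proof.
elim: k => [|k IH]; rewrite ?expr0 ?trmx1 //.
by rewrite exprS [RHS]exprSr trmx_mul IH.
Qed.

(** The columns A^j v are obtained as the transpose of the Krylov rows of A^T.
    The cases of interest are B = 1, which gives the Hankel matrix, and B = A,
    which gives the shifted Hankel matrix.  Both are symmetric. *)
Lemma krylov_form (F : fieldType) (n : nat) (A B : 'M[F]_n)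
    (f : 'rV[F]_n) (v : 'cV[F]_n) (d : nat) (i j : 'I_d) :
  (krylov A f d *m B *m (krylov A^T v^T d)^T) i j =
  (f *m A ^+ i *m B *m A ^+ j *m v) 0 0.
Proof.
have colC : col j (krylov A^T v^T d)^T = A ^+ j *m v.
  by rewrite -tr_row rowK -trmxX -trmx_mul trmxK.
transitivity (row i (col j (krylov A f d *m B *m (krylov A^T v^T d)^T)) 0 0).
  by rewrite !mxE.
rewrite colE -mulmxA -colE colC !row_mul rowK.
by rewrite !mulmxA.
Qed.

Lemma krylov_mul_hankel (F : fieldType) (n : nat) (A : 'M[F]_n)
    (f : 'rV[F]_n) (v : 'cV[F]_n) (d : nat) :
  krylov A f d *m (krylov A^T v^T d)^T = hankel A f v d.
Proof.
apply/matrixP=> i j; rewrite -[krylov A f d]mulmx1 krylov_form mulmx1.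
by rewrite [RHS]mxE exprD -[A ^+ i * _]/(A ^+ i *m _) mulmxA.
Qed.

(** This exchanges the roles of rows and columns: a fact about the rows f A^i
    yields the one about the columns A^j v. *)
Lemma hankel_trmx (F : fieldType) (n : nat) (A : 'M[F]_n)
    (f : 'rV[F]_n) (v : 'cV[F]_n) (d : nat) :
  hankel A^T v^T f^T d = hankel A f v d.
Proof.
apply/matrixP=> i j; rewrite mxE -trmxX -!trmx_mul mxE [RHS]mxE.
by rewrite mulmxA.
Qed.

Lemma tr_hankel (F : fieldType) (n : nat) (A : 'M[F]_n)
    (f : 'rV[F]_n) (v : 'cV[F]_n) (d : nat) :
  (hankel A f v d)^T = hankel A f v d.
Proof. by apply/matrixP=> i j; rewrite !mxE addnC. Qed.

(** Reversing the order of the columns turns the matrix into a triangular one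
    with ones on the diagonal. *)
Lemma hankel_antitriangular (F : fieldType) (n : nat) (A : 'M[F]_n)
    (f : 'rV[F]_n) (w : 'cV[F]_n) (d : nat) :
  (forall k, (k < d)%N -> (f *m A ^+ k *m w) 0 0 = 0) ->
  (f *m A ^+ d *m w) 0 0 = 1 ->
  hankel A f w d.+1 \in unitmx.
Proof.
move=> lt0 eq1; pose s := perm (@rev_ord_inj d.+1).
have trigH : is_trig_mx (col_perm s (hankel A f w d.+1)).
  apply/is_trig_mxP=> i j ltij; rewrite mxE mxE permE /= lt0 //.
  have := ltn_ord j; lia.
have: col_perm s (hankel A f w d.+1) \in unitmx.
  rewrite unitmxE det_trig // big1 ?unitr1 // => i _.
  by rewrite mxE mxE permE /= subSS subnKC // -ltnS.
by rewrite col_permE unitmx_mul unitmx_perm andbT.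
Qed.

(** If f A^d is independent of the previous f A^i, some column pairs to 1 with
    the former and to 0 with the latter, which makes the next Hankel matrix
    antitriangular.  Multiplying that column by E does not change the pairings,
    as f A^i E = f A^i: the extension takes place inside the summand E. *)
Lemma krylov_extend (F : fieldType) (n : nat) (A E : 'M[F]_n)
    (f : 'rV[F]_n) (d : nat) :
  E *m A = A *m E -> E *m E = E -> f *m E = f ->
  ~~ (krylov A f d *m A <= krylov A f d)%MS ->
  exists2 w : 'cV[F]_n, E *m w = w & hankel A f w d.+1 \in unitmx.
Proof.
move=> cEA EE fE nstab.
(* Only the last row of krylov * A can leave the row space. *)
have {nstab}: ~~ (f *m A ^+ d <= krylov A f d)%MS.
  apply: contra nstab => topK; apply/row_subP=> i.
  rewrite row_mul rowK -mulmxA -[_ *m A]exprSr.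
  have [eq_d|neq_d] := eqVneq i.+1 d.
    by move: topK; rewrite -[X in _ ^+ X]eq_d.
  have lt_d : (i.+1 < d)%N by rewrite ltn_neqAle neq_d ltn_ord.
  have <- : row (Ordinal lt_d) (krylov A f d) = f *m A ^+ i.+1 by rewrite rowK.
  exact: row_sub.
(* The columns of the cokernel of K are killed by K and detect membership in
   its row space. *)
rewrite submxE => /rV0Pn[j nz_j].
set c := (f *m _ *m _) 0 j in nz_j.
pose u := col j (cokermx (krylov A f d)).
have fXE k : f *m A ^+ k *m E = f *m A ^+ k.
  have cEX : GRing.comm E (A ^+ k) by apply: commrX.
  by rewrite -mulmxA -[A ^+ k *m E]cEX mulmxA fE.
exists (c^-1 *: (E *m u)); first by rewrite -scalemxAr mulmxA EE.
apply: hankel_antitriangular => [k ltk|]; rewrite -scalemxAr mulmxA fXE.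
  have -> : f *m A ^+ k = row (Ordinal ltk) (krylov A f d) by rewrite rowK.
  rewrite -row_mul /u colE mulmxA mulmx_coker mul0mx row0 scaler0.
  by rewrite mxE.
by rewrite /u colE mulmxA -colE mxE [X in _ * X]mxE mulVf.
Qed.

(** As long as one of the two Krylov spaces is not stable, a larger invertible
    Hankel matrix exists; its size is bounded by n, so the process stops. *)
Lemma krylov_bistable (F : fieldType) (n : nat) (A E : 'M[F]_n) :
  E *m A = A *m E -> E *m E = E -> E != 0 ->
  exists d (f : 'rV[F]_n) (v : 'cV[F]_n),
    [/\ f *m E = f, E *m v = v & (0 < d)%N] /\
    [/\ hankel A f v d \in unitmx, (krylov A f d *m A <= krylov A f d)%MS &
        (krylov A^T v^T d *m A^T <= krylov A^T v^T d)%MS].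
Proof.
move=> cEA EE nzE.
have [d [f [v [fE Ev d_gt0 uH]]]] : exists d (f : 'rV[F]_n) (v : 'cV[F]_n),
    [/\ f *m E = f, E *m v = v, (0 < d)%N & hankel A f v d \in unitmx].
  (* As E is idempotent, row i times column j of E is E i j. *)
  have /matrix0Pn[i [j nzEij]] := nzE.
  exists 1%N, (row i E), ((E i j)^-1 *: col j E); split=> //.
  - by rewrite -row_mul EE.
  - by rewrite -scalemxAr colE mulmxA EE.
  apply: hankel_antitriangular => //; rewrite expr0 mulmx1 -scalemxAr.
  by rewrite colE mulmxA -row_mul EE -colE mxE [X in _ * X]mxE mxE mulVf.
have [m lt_n] : exists m, (n < d + m)%N by exists n.+1; rewrite leq_addl.
elim: m d f v fE Ev d_gt0 uH lt_n => [|m IH] d f v fE Ev d_gt0 uH lt_n.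
  (* An invertible Hankel matrix factors through F^n, so d <= n. *)
  suff: (d <= n)%N by rewrite leqNgt -[d]addn0 lt_n.
  rewrite -(mxrank_unit uH) -krylov_mul_hankel.
  exact: leq_trans (mxrankM_maxl _ _) (rank_leq_col _).
have [stabf|] := boolP (krylov A f d *m A <= krylov A f d)%MS; last first.
  case/(krylov_extend cEA EE fE)=> w Ew uHw.
  by apply: (IH d.+1 f w) => //; rewrite addSnnS.
have [stabv|] := boolP (krylov A^T v^T d *m A^T <= krylov A^T v^T d)%MS.
  by exists d, f, v.
have cEAT : E^T *m A^T = A^T *m E^T by rewrite -!trmx_mul cEA.
have EET : E^T *m E^T = E^T by rewrite -trmx_mul EE.
have vET : v^T *m E^T = v^T by rewrite -trmx_mul Ev.
case/(krylov_extend cEAT EET vET)=> w Ew uHw.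
apply: (IH d.+1 w^T v) => //; last by rewrite addSnnS.
  by rewrite -[E]trmxK -trmx_mul Ew.
by rewrite -hankel_trmx trmxK.
Qed.

(** * Similarity of a matrix and its transpose *)

(** On the image of the idempotent E, P is an isomorphism from A to A^T whose
    inverse is Q.  The absorption conditions make the sum over orthogonal
    idempotents work: cross terms of Q P vanish. *)
Definition transpose_intertwined (F : fieldType) (n : nat) (A E : 'M[F]_n) :=
  exists P Q : 'M[F]_n,
    [/\ P *m A = A^T *m P, E^T *m P = P, Q *m E^T = Q & Q *m P = E].

(** The image of the projection C H^-1 K is the cyclic space spanned by the
    A^j v.  In coordinates, A acts on rows by M and on columns by
    N = H^-1 M H, and H^-1 M = H^-1 (K A C) H^-1 is symmetric because K A C is
    again a Hankel matrix; this is why K^T H^-1 K intertwines A and A^T. *)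
Lemma cyclic_summand (F : fieldType) (n : nat) (A E : 'M[F]_n) :
  E *m A = A *m E -> E *m E = E -> E != 0 ->
  exists p : 'M[F]_n,
    [/\ p != 0, p *m p = p, p *m A = A *m p, p *m E = p & E *m p = p] /\
    transpose_intertwined A p.
Proof.
move=> cEA EE nzE.
have [d [f [v [[fE Ev d_gt0] [uH stabK stabC]]]]] := krylov_bistable cEA EE nzE.
set K := krylov A f d in stabK; set H := hankel A f v d in uH.
pose C := (krylov A^T v^T d)^T; pose G := invmx H.
have commE k : E * A ^+ k = A ^+ k * E by apply: commrX.
have KC : K *m C = H by apply: krylov_mul_hankel.
have symH : H^T = H by apply: tr_hankel.
have symG : G^T = G by rewrite /G trmx_inv symH.
have GH : G *m H = 1%:M by apply: mulVmx.
have HG : H *m G = 1%:M by apply: mulmxV.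
have [M KA] : exists M, K *m A = M *m K by apply/submxP.
have [N AC] : exists N, A *m C = C *m N.
  have /submxP[N eqN] := stabC; exists N^T.
  by apply: trmx_inj; rewrite !trmx_mul /C !trmxK.
have MH : M *m H = H *m N by rewrite -KC mulmxA -KA -!mulmxA AC.
have GM : G *m M = N *m G.
  by rewrite -[M]mulmx1 -HG (mulmxA M) MH !mulmxA GH mul1mx.
have symKAC : (K *m A *m C)^T = K *m A *m C.
  apply/matrixP=> i j; rewrite mxE !krylov_form.
  have shift k l : f *m A ^+ k *m A *m A ^+ l = f *m A ^+ (k + l).+1.
    by rewrite -addSn exprD exprSr !mulmxA.
  by rewrite !shift addnC.
have symGM : (G *m M)^T = G *m M.
  have -> : G *m M = G *m (K *m A *m C) *m G.
    by rewrite KA -!mulmxA (mulmxA K) KC HG mulmx1.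
  by rewrite 2!trmx_mul symKAC symG mulmxA.
have KE : K *m E = K.
  apply/row_matrixP=> i; rewrite row_mul rowK -mulmxA.
  by rewrite -[_ *m E]commE mulmxA fE.
have EC : E *m C = C.
  apply/trmx_inj; rewrite trmx_mul trmxK; apply/row_matrixP=> i.
  rewrite row_mul rowK -trmxX -!trmx_mul mulmxA.
  by rewrite -[E *m _]/(E * _) commE -mulmxA Ev.
exists (C *m G *m K); split.
  split.
  - apply: contraTneq d_gt0 => p0.
    have: K *m (C *m G *m K) *m C = 0 by rewrite p0 mulmx0 mul0mx.
    rewrite !mulmxA KC HG mul1mx KC => H0.
    by move: (mxrank_unit uH); rewrite H0 mxrank0 => <-.
  - by rewrite -!mulmxA (mulmxA K) KC (mulmxA G) GH mul1mx.
  - by rewrite -mulmxA KA !mulmxA AC -!mulmxA (mulmxA G) GM !mulmxA.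
  - by rewrite -mulmxA KE.
  - by rewrite !mulmxA EC.
have KCT : C^T *m K^T = H by rewrite -trmx_mul KC symH.
exists (K^T *m G *m K), (C *m G *m C^T); split.
- rewrite -!mulmxA KA !mulmxA -trmx_mul KA trmx_mul -!mulmxA.
  by congr (_ *m _); rewrite !mulmxA -{1}symGM trmx_mul symG.
- by rewrite !trmx_mul symG -!mulmxA (mulmxA C^T) KCT (mulmxA H) HG mul1mx.
- by rewrite !trmx_mul symG -!mulmxA (mulmxA C^T) KCT (mulmxA H) HG mul1mx.
- by rewrite -!mulmxA (mulmxA C^T) KCT (mulmxA H) HG mul1mx.
Qed.

(** Splitting off one cyclic summand p leaves the idempotent E - p, which is
    orthogonal to p and has smaller rank. *)
Lemma idempotent_transpose_intertwined (F : fieldType) (n : nat)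
    (A E : 'M[F]_n) :
  E *m A = A *m E -> E *m E = E -> transpose_intertwined A E.
Proof.
have [r] := ubnP (\rank E); elim: r E => // r IH E ltEr cEA EE.
have [->|nzE] := eqVneq E 0.
  by exists 0, 0; rewrite trmx0 !mul0mx !mulmx0.
have [p [[nzp pp cpA pE Ep] [P1 [Q1 [P1A pP1 Q1p QP1]]]]] :=
  cyclic_summand cEA EE nzE.
have pD : p *m (E - p) = 0 by rewrite mulmxBr pE pp subrr.
have Dp : (E - p) *m p = 0 by rewrite mulmxBl Ep pp subrr.
have DE : (E - p) *m E = E - p by rewrite mulmxBl EE pE.
have ED : E *m (E - p) = E - p by rewrite mulmxBr EE Ep.
have [||| P2 [Q2 [P2A DP2 Q2D QP2]]] := IH (E - p).
- have leD : (E - p <= E)%MS by apply/submxP; exists (E - p).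
  have ltD : (E - p < E)%MS.
    (* If E = X (E - p), then p = E p = X (E - p) p = 0. *)
    rewrite ltmxE leD; apply: contra nzp => /submxP[X eqE].
    by rewrite -Ep eqE -mulmxA Dp mulmx0.
  by move: ltD; rewrite ltmxErank leD => /leq_trans; apply.
- by rewrite mulmxBl mulmxBr cEA cpA.
- by rewrite {1}mulmxBl ED pD subr0.
exists (P1 + P2), (Q1 + Q2); split.
- by rewrite mulmxDl mulmxDr P1A P2A.
- rewrite mulmxDr -{1}pP1 -{1}DP2 !mulmxA -!trmx_mul pE DE.
  by rewrite pP1 DP2.
- rewrite mulmxDl -{1}Q1p -{1}Q2D -!mulmxA -!trmx_mul Ep ED.
  by rewrite Q1p Q2D.
(* Q1 P2 and Q2 P1 vanish by orthogonality of p and E - p. *)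
rewrite mulmxDl !mulmxDr QP1 QP2.
rewrite -{1}Q1p -{1}DP2 -mulmxA (mulmxA p^T) -trmx_mul Dp trmx0 mul0mx mulmx0.
rewrite -{1}Q2D -{1}pP1 -mulmxA (mulmxA _^T p^T) -trmx_mul pD trmx0 mul0mx mulmx0.
by rewrite addr0 add0r addrC subrK.
Qed.

Lemma similar_trmx (F : fieldType) (n : nat) (A : 'M[F]_n) :
  exists2 P : 'M[F]_n, P \in unitmx & P *m A *m invmx P = A^T.
Proof.
have [||P [Q [PA _ _ QP]]] := @idempotent_transpose_intertwined F n A 1%:M.
- by rewrite mulmx1 mul1mx.
- exact: mulmx1.
have [_ uP] := mulmx1_unit QP.
by exists P => //; rewrite PA mulmxK.
Qed.

(** * Anti-automorphisms of sl_n *)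

Lemma conj_trmx_traceless (F : fieldType) (n : nat) (P : 'M[F]_n)
    (uP : P \in unitmx) (Y : sl F n) :
  (P *m Y *m invmx P)^T \in @traceless F n.
Proof.
rewrite unfold_in mxtrace_tr mxtrace_mulC mulKmx //.
exact: (sl_valP Y).
Qed.

Definition conj_trmx (F : fieldType) (n : nat) (P : 'M[F]_n)
    (uP : P \in unitmx) (Y : sl F n) : sl F n :=
  Sl (conj_trmx_traceless uP Y).

Lemma conj_trmx_is_linear (F : fieldType) (n : nat) (P : 'M[F]_n)
    (uP : P \in unitmx) : linear (@conj_trmx F n P uP).
Proof.
move=> a Y Z; apply: val_inj; rewrite /= mulmxDr mulmxDl.
by rewrite -scalemxAr -scalemxAl linearP.
Qed.

HB.instance Definition _ (F : fieldType) (n : nat) (P : 'M[F]_n)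
    (uP : P \in unitmx) :=
  GRing.isLinear.Build F (sl F n) (sl F n) *:%R (@conj_trmx F n P uP)
    (conj_trmx_is_linear uP).

Lemma conj_trmx_anti_automorphism (F : fieldType) (n : nat) (P : 'M[F]_n)
    (uP : P \in unitmx) : lie_anti_automorphism (@conj_trmx F n P uP).
Proof.
split=> [|Y Z].
  have uPT : P^T \in unitmx by rewrite unitmx_tr.
  (* The inverse of Y |-> (P Y P^-1)^T is the map of the same kind for P^T. *)
  exists (conj_trmx uPT) => X; apply: val_inj => /=.
    by rewrite -trmx_inv -!trmx_mul trmxK mulmxKV // mulKmx.
  by rewrite 2!trmx_mul trmxK trmx_inv mulmxKV // mulKmx.
apply: val_inj; rewrite /= mulmxBr mulmxBl raddfB /=.
by rewrite -!trmx_mul !mulmxA !mulmxKV.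
Qed.

Lemma fixed_by_anti_automorphism (F : fieldType) (n : nat) (X : sl F n) :
  exists2 psi : {linear sl F n -> sl F n},
    lie_anti_automorphism psi & psi X = X.
Proof.
have [P uP eqX] := similar_trmx (sl_val X).
exists (@conj_trmx F n P uP); first exact: conj_trmx_anti_automorphism.
by apply: val_inj; rewrite /= eqX trmxK.
Qed.

Lemma comp_anti_automorphisms (F : fieldType) (L : lieAlgType F)
    (phi psi : {linear L -> L}) :
  lie_anti_automorphism phi -> lie_anti_automorphism psi ->
  lie_automorphism (phi \o psi).
Proof.
move=> [bphi phiE] [bpsi psiE]; split; first exact: bij_comp.
by move=> x y; rewrite /= psiE phiE.
Qed.

Theorem proposition2p1 (F : fieldType) (charF0 : [pchar F] =i pred0)
    (n : nat) (hn : (2 <= n)%N) (phi : {linear sl F n -> sl F n}) :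
  lie_anti_automorphism phi -> local_automorphism phi.
Proof.
move=> anti_phi X; have [psi anti_psi psiX] := fixed_by_anti_automorphism X.
exists (phi \o psi); split; first exact: comp_anti_automorphisms.
by rewrite /= psiX.
Qed.
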